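(* Let $G$ be a locally compact, second countable, compactly generated group with left Haar measure $\mu$. Suppose that $G$ has polynomial growth and homogeneous dimension $d_h$. Then there exists a continuous, proper, negative type function $\ell:G\to[0,+\infty)$ with polynomial growth such that, for every real $d>d_h$, $$\mu\{s\in G\,|\,\ell(s)\le x\}=O(x^{d}),\qquad x\to+\infty .$$ (The function $\ell$ does not depend on $d$.)
   Context: Let $K\subset G$ be a compact, symmetric ($K=K^{-1}$) generating set which is a neighborhood of the identity $e\in G$, so that $G=\bigcup_{n\ge1}K^n$ with $K^n=\{s_1\cdots s_n: s_1,\dots,s_n\in K\}$. The group $G$ has polynomial growth if there exist $c,d>0$ such that $\mu(K^n)\le c\,(n+1)^d$ for all $n\ge1$. In that case its homogeneous dimension is $d_h=\limsup_{n\to\infty}\frac{\log\mu(K^n)}{\log n}$. Both the property and $d_h$ are independent of the choice of such a $K$. A negative type (equivalently, negative definite) function is a function $\ell:G\to[0,+\infty)$ with $\ell(e)=0$, $\ell(s^{-1})=\ell(s)$ for all $s\in G$, and $\sum_{i,j=1}^n \overline{c_i}\,c_j\,\ell(s_i^{-1}s_j)\le 0$ for all $n\ge1$, $s_1,\dots,s_n\in G$ and $c_1,\dots,c_n\in\mathbb{C}$ with $\sum_i c_i=0$. A continuous function $\ell$ is proper if $\{s\in G:\ell(s)\le x\}$ is compact for every $x\ge0$. It has polynomial growth if $\mu\{s\in G:\ell(s)\le x\}=O(x^{d'})$ as $x\to+\infty$ for some $d'>0$. *)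

(* Defs.v *)
From HB Require Import structures.
From mathcomp Require Import all_boot all_order all_algebra.
From mathcomp Require Import complex.
From mathcomp Require Import all_classical all_reals all_analysis.
Set Implicit Arguments.
Unset Strict Implicit.
Unset Printing Implicit Defensive.
Import Order.TTheory GRing.Theory Num.Theory.
Import numFieldNormedType.Exports.

Local Open Scope classical_set_scope.
Local Open Scope ring_scope.

HB.mixin Record isTopologicalGroup G & Topological G & Group G := {
  mulg_continuous : continuous (fun x : G * G => (x.1 * x.2)%g) ;
  invg_continuous : continuous (fun x : G => x^-1%g)
}.

(* The pointed structure is only there because [g_sigma_algebraType] requires
   it; its point is unrelated to the identity and plays no role. *)
#[short(type="topologicalGroupType")]
HB.structure Definition TopologicalGroup :=
  {G of PointedTopological G & Group G & isTopologicalGroup G}.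

Notation borel G := (g_sigma_algebraType (@open G)).

Section Definitions.
Variables (R : realType) (G : topologicalGroupType).
Implicit Types (K H A U : set G) (mu : {measure set (borel G) -> \bar R}).

(* Left Haar measure: a nonzero left-invariant Radon measure. *)
Record left_haar mu : Prop := {
  haar_neq0 : mu setT != 0%E ;
  haar_invariant : forall (g : G) A, (measurable (A : set (borel G))) ->
    mu [set (g * x)%g | x in A] = mu A ;
  haar_compact : forall K, compact K -> (mu K < +oo)%E ;
  haar_outer : forall A, measurable (A : set (borel G)) ->
    mu A = ereal_inf [set mu U | U in [set U : set G | open U /\ A `<=` U]] ;
  haar_inner : forall U, open U ->
    mu U = ereal_sup [set mu K | K in [set K : set G | compact K /\ K `<=` U]]
}.

Definition generating K : Prop := forall H,
  H 1%g -> (forall x y, H x -> H y -> H (x * y)%g) ->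
  (forall x, H x -> H x^-1%g) -> K `<=` H -> H = setT.

Record growth_set K : Prop := {
  growth_set_compact : compact K ;
  growth_set_symmetric : [set x^-1%g | x in K] = K ;
  growth_set_generating : generating K ;
  growth_set_nbhs : nbhs (1%g : G) K
}.

Definition set_power K (n : nat) : set G :=
  [set x | exists2 s : 'I_n -> G,
     (forall i, K (s i)) & x = (\prod_(i < n) s i)%g].

Definition group_polynomial_growth mu K : Prop :=
  exists c d : R, [/\ 0 < c, 0 < d & forall n : nat, (1 <= n)%N ->
    (mu (set_power K n) <= (c * n.+1%:R `^ d)%:E)%E].

(* The terms at n = 0, 1 are junk values, irrelevant to the limsup. *)
Definition homogeneous_dimension mu K : \bar R :=
  limn_esup (fun n : nat => lne (mu (set_power K n)) * (ln n%:R)^-1%:E)%E.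

Definition negative_type (l : G -> R) : Prop :=
  [/\ forall s, 0 <= l s,
      l 1%g = 0,
      forall s, l s^-1%g = l s &
      forall (n : nat) (s : 'I_n -> G) (c : 'I_n -> R[i]),
        \sum_(i < n) c i = 0 ->
        \sum_(i < n) \sum_(j < n)
          (c i)^* * c j * (l ((s i)^-1 * s j)%g)%:C%C <= 0].

Definition proper_function (l : G -> R) : Prop :=
  forall x : R, 0 <= x -> compact [set s | l s <= x].

(* mu {s | l s <= x} = O(x^d) as x -> +oo; as the left-hand side is an extended
   real, this includes its finiteness for large x. *)
Definition sublevel_bigO mu (l : G -> R) (d : R) : Prop :=
  exists C : R, \forall x \near +oo_R,
    (mu [set s | (l s <= x)%R] <= (C * x `^ d)%:E)%E.

Definition function_polynomial_growth mu (l : G -> R) : Prop :=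
  exists2 d : R, 0 < d & sublevel_bigO mu l d.

End Definitions.

(* Main.v *)
(* For a compact set B of positive measure, the function
     psi_B(s) = mu(sB \ B) / mu(B) = 1 - mu(sB n B) / mu(B)
   is of negative type, since mu(sB n tB) is a Gram kernel; it is symmetric and
   subadditive, tends to 0 at the identity by outer regularity, and equals 1
   where sB and B are disjoint. For B = K^k and s in K it is at most
   mu(K^(k+1)) / mu(K^k) - 1. As log mu(K^n) = O(log n), some k in
   [2^j, 2^(j+1)) makes this bound at most C (j+1) / 2^j; call it k_j. Then
     l = sum_j 2^j / (j+1)^3 * psi_(K^(k_j))
   converges on K like sum_j (j+1)^-2, hence everywhere by subadditivity, and
   l >= 2^j / (j+1)^3 off K^(2^(j+2)). So {l <= x} lies in some K^n with n
   equal to x up to a power of log x, which costs no exponent d > d_h. *)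

Require Import Defs.
From HB Require Import structures.
From mathcomp Require Import all_boot all_order all_algebra.
From mathcomp Require Import complex finmap ring lra.
From mathcomp Require Import all_classical all_reals all_analysis measurable_realfun.
Import Order.TTheory GRing.Theory Num.Theory.
Import numFieldNormedType.Exports.
Local Open Scope classical_set_scope.
Local Open Scope ring_scope.

(** * Powers of a set in a topological group *)

Section TopologicalGroups.
Variable G : topologicalGroupType.
Implicit Types (A B K U : set G) (g s t x y : G).

Lemma cvg_mulg (T : Type) (F : set_system T) (FF : Filter F) (f h : T -> G) x y :
  f @ F --> x -> h @ F --> y -> (fun i => (f i * h i)%g) @ F --> (x * y)%g.
Proof.
move=> fx hy.
have := @cvg_comp _ _ _ (fun i => (f i, h i)) (fun z : G * G => (z.1 * z.2)%g) F _ _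
  (cvg_pair fx hy) (@mulg_continuous G (x, y)).
exact.
Qed.

Lemma mulgl_continuous g : continuous (fun x : G => (g * x)%g).
Proof. by move=> x; apply: cvg_mulg; [exact: cvg_cst|exact: cvg_id]. Qed.

Lemma compact_mulgl g A : compact A -> compact [set (g * x)%g | x in A].
Proof.
move=> cA; apply: continuous_compact => //.
by apply: continuous_subspaceT; exact: mulgl_continuous.
Qed.

Lemma mulgl_imageE g A : [set (g * x)%g | x in A] = (fun x : G => g^-1 * x)%g @^-1` A.
Proof.
apply/seteqP; split => [_ [x Ax <-]|x /= Ax]; first by rewrite /= mulKg.
by exists (g^-1 * x)%g => //; rewrite mulVKg.
Qed.

Lemma open_mulgl g A : open A -> open [set (g * x)%g | x in A].
Proof.
rewrite mulgl_imageE; apply: open_comp => x _; exact: mulgl_continuous.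
Qed.

Lemma mulgl_image_comp g h A :
  [set (g * x)%g | x in [set (h * x)%g | x in A]] = [set (g * h * x)%g | x in A].
Proof.
apply/seteqP; split => [_ [_ [x Ax <-] <-]|_ [x Ax <-]].
  by exists x => //; rewrite mulgA.
by exists (h * x)%g; [exists x|rewrite mulgA].
Qed.

Lemma mulgl_image1 A : [set (1 * x)%g | x in A] = A.
Proof. by rewrite mulgl_imageE invg1; apply/seteqP; split=> x /=; rewrite mul1g. Qed.

Lemma mulgl_imageI g A B : [set (g * x)%g | x in A `&` B] =
  [set (g * x)%g | x in A] `&` [set (g * x)%g | x in B].
Proof. by rewrite !mulgl_imageE. Qed.

(** Continuity of multiplication at the identity and [x] handles a neighbourhood of each point [x]
    of [A]; compactness of [A] makes the condition on [g] uniform. *)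
Lemma tube_mulgl A U : compact A -> open U -> A `<=` U ->
  \forall g \near (1%g : G), [set (g * x)%g | x in A] `<=` U.
Proof.
move=> /compact_near_coveringP cA oU AU.
have /(cA G (nbhs (1%g : G)) (fun g x => U (g * x)%g)) : forall x, A x ->
    \forall x' \near x & g \near (1%g : G), U (g * x')%g.
  move=> x Ax.
  have h : (fun z : G * G => (z.2 * z.1)%g) z @[z --> (x, 1%g : G)] --> (1 * x)%g.
    by apply: cvg_mulg; [exact: cvg_snd|exact: cvg_fst].
  apply: h; rewrite mul1g; apply: open_nbhs_nbhs; split => //; exact: AU.
by apply: filterS => g AUg _ [x Ax <-]; exact: AUg.
Qed.

Lemma set_powerSP K n x :
  set_power K n.+1 x <-> exists y k, [/\ set_power K n y, K k & x = (y * k)%g].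
Proof.
split=> [[s Ks ->]|[y [k [[s Ks ->] Kk ->]]]].
  rewrite big_ord_recr; do 2 eexists; split; last reflexivity.
    by exists (fun i => s (widen_ord (leqnSn n) i)).
  exact: Ks.
(* The word of length [n] is extended by [k] in the last position [ord_max]. *)
exists (fun i : 'I_n.+1 => if unlift ord_max i is Some j then s j else k).
  by move=> i; case: unliftP.
rewrite big_ord_recr /= unlift_none; congr (_ * _)%g.
apply: eq_bigr => i _.
have -> : widen_ord (leqnSn n) i = lift ord_max i.
  by apply: val_inj; rewrite /= /bump leqNgt ltn_ord.
by rewrite liftK.
Qed.

Lemma set_power_mul K m n x y :
  set_power K m x -> set_power K n y -> set_power K (m + n) (x * y)%g.
Proof.
elim: n y => [|n IH] y Kx.
  by move=> [s _ ->]; rewrite big_ord0 mulg1 addn0.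
move=> /set_powerSP[z [k [Kz Kk ->]]]; rewrite addnS.
by apply/set_powerSP; exists (x * z)%g, k; split; [exact: IH| |rewrite mulgA].
Qed.

Lemma set_power0 K : set_power K 0 = [set 1%g].
Proof.
apply/seteqP; split => [x [s _ ->]|_ ->]; first by rewrite big_ord0.
by exists (fun=> 1%g); [case|rewrite big_ord0].
Qed.

Lemma set_power1 K : set_power K 1 = K.
Proof.
apply/seteqP; split=> x.
  move=> /set_powerSP[y [k [+ Kk ->]]].
  by rewrite set_power0 => ->; rewrite mul1g.
move=> Kx; apply/set_powerSP; exists 1%g, x.
by split => //; [rewrite set_power0|rewrite mul1g].
Qed.

Lemma set_power_inv K n x : [set x^-1%g | x in K] = K ->
  set_power K n x -> set_power K n x^-1%g.
Proof.
move=> KV; elim: n x => [|n IH] x; first by rewrite set_power0 => ->; rewrite /= invg1.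
move=> /set_powerSP[y [k [Ky Kk ->]]]; rewrite invgM -add1n.
apply: set_power_mul; last exact: IH.
by rewrite set_power1 -KV; exists k.
Qed.

Lemma set_power_sub K m n : K 1%g -> (m <= n)%N -> set_power K m `<=` set_power K n.
Proof.
move=> K1 /subnK <-; elim: (n - m)%N => // k IH x /IH Kx.
by rewrite addSn; apply/set_powerSP; exists x, 1%g; rewrite mulg1.
Qed.

Lemma compact_set_power K n : compact K -> compact (set_power K n).
Proof.
move=> cK; elim: n => [|n IH]; first by rewrite set_power0; exact: compact_set1.
have -> : set_power K n.+1 = (fun z : G * G => (z.1 * z.2)%g) @` (set_power K n `*` K).
  apply/seteqP; split => [x /set_powerSP[y [k [Ky Kk ->]]]|_ [[y k] [/= Ky Kk] <-]].
    by exists (y, k).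
  by apply/set_powerSP; exists y, k.
apply: continuous_compact; last exact: compact_setX.
by apply: continuous_subspaceT; exact: mulg_continuous.
Qed.

(** The union of the powers is a subgroup containing [K]; symmetry of [K] gives the inverses. *)
Lemma set_power_exhaust K : [set x^-1%g | x in K] = K -> generating K ->
  forall x, exists n, set_power K n x.
Proof.
move=> KV genK x.
suff : [set x | exists n, set_power K n x] = setT by move=> /seteqP[_]; exact.
apply: genK => /=.
- by exists 0%N; rewrite set_power0.
- by move=> y z [m Km] [n Kn]; exists (m + n)%N; exact: set_power_mul.
- by move=> y [n Kn]; exists n; exact: set_power_inv.
- by move=> k Kk; exists 1%N; rewrite set_power1.
Qed.

End TopologicalGroups.

(** * Haar measure and translation defects *)

(** The double sum is the integral of the square of the step function with value [a i] on each
    [A i], because a product of indicators is the indicator of the intersection. *)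
Lemma gram_measure_ge0 d (T : measurableType d) (R : realType)
    (mu : {measure set T -> \bar R}) n (A : 'I_n -> set T) (a : 'I_n -> R) :
  (forall i, measurable (A i)) -> (forall i, (mu (A i) < +oo)%E) ->
  0 <= \sum_(i < n) \sum_(j < n) a i * a j * fine (mu (A i `&` A j)).
Proof.
move=> mA fA.
have mI i j : measurable (A i `&` A j) by exact: measurableI.
have fI i j : (mu (A i `&` A j) < +oo)%E by exact: le_lt_trans (measureIl _ _ _) (fA i).
have intI i j : mu.-integrable setT (fun x => (\1_(A i `&` A j) x)%:E).
  apply/integrableP; split; first exact/measurable_EFinP/measurable_indic.
  under eq_integral do rewrite gee0_abs ?lee_fin//.
  by rewrite integral_indic// setIT.
rewrite -lee_fin.
suff -> : (\sum_(i < n) \sum_(j < n) a i * a j * fine (mu (A i `&` A j)))%:E =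
    (\int[mu]_x ((\sum_(i < n) a i * \1_(A i) x) ^+ 2)%:E)%E.
  by apply: integral_ge0 => x _; rewrite lee_fin sqr_ge0.
under [RHS]eq_integral => x _.
  have -> : ((\sum_(i < n) a i * \1_(A i) x) ^+ 2)%:E =
      (\sum_(i < n) \sum_(j < n) ((a i * a j)%:E * (\1_(A i `&` A j) x)%:E))%E.
    rewrite expr2 mulr_suml -sumEFin; apply: eq_bigr => i _.
    rewrite mulr_sumr -sumEFin; apply: eq_bigr => j _.
    by rewrite indicI /= -EFinM mulrACA.
  over.
rewrite integral_sum//; last first.
  by move=> i; apply: integrable_sum => // j _; exact: integrableZl.
rewrite -sumEFin; apply: eq_bigr => i _.
rewrite integral_sum//; last by move=> j; exact: integrableZl.
rewrite -sumEFin; apply: eq_bigr => j _.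
rewrite integralZl// integral_indic// setIT EFinM fineK//.
by rewrite ge0_fin_numE// measure_ge0.
Qed.

Section TranslationDefect.
Variables (R : realType) (G : topologicalGroupType).
Variable mu : {measure set (borel G) -> \bar R}.
Hypotheses (hausdorffG : hausdorff_space G) (haar_mu : left_haar mu).
Implicit Types (A B K : set G) (s t : G).

Lemma closed_borel A : closed A -> measurable (A : set (borel G)).
Proof.
move=> /closed_openC oA; rewrite -[A]setCK; apply: (@measurableC _ (borel G)).
exact: sub_sigma_algebra.
Qed.

Lemma compact_borel A : compact A -> measurable (A : set (borel G)).
Proof. by move=> cA; apply: closed_borel; exact: compact_closed. Qed.

Lemma borelD A B : measurable (A : set (borel G)) -> measurable (B : set (borel G)) ->
  measurable (A `\` B : set (borel G)).
Proof. exact: (@measurableD _ (borel G)). Qed.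

Lemma borelI A B : measurable (A : set (borel G)) -> measurable (B : set (borel G)) ->
  measurable (A `&` B : set (borel G)).
Proof. exact: (@measurableI _ (borel G)). Qed.

Lemma haar_le A B : measurable (A : set (borel G)) -> measurable (B : set (borel G)) ->
  A `<=` B -> (mu A <= mu B)%E.
Proof. by move=> mA mB AB; exact: (@le_measure _ _ (borel G) mu _ _ (mem_set mA) (mem_set mB) AB). Qed.

Lemma haarD A B : measurable (A : set (borel G)) -> measurable (B : set (borel G)) ->
  (mu A < +oo)%E -> mu (A `\` B) = (mu A - mu (A `&` B))%E.
Proof. exact: (@measureD _ (borel G)). Qed.

Lemma haarU_le A B : measurable (A : set (borel G)) -> measurable (B : set (borel G)) ->
  (mu (A `|` B) <= mu A + mu B)%E.
Proof. exact: (@measureU2 _ (borel G)). Qed.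

Lemma haar_fin_num A : compact A -> mu A \is a fin_num.
Proof. by move=> cA; rewrite ge0_fin_numE ?measure_ge0//; exact: haar_compact haar_mu _ cA. Qed.

(** Otherwise finitely many null translates of [A] would cover any given compact set, and inner
    regularity of the whole group would force [mu] to vanish. *)
Lemma haar_nbhs_gt0 A : compact A -> nbhs (1%g : G) A -> (0 < mu A)%E.
Proof.
move=> cA nA; rewrite lt0e measure_ge0 andbT; apply/eqP => A0.
have /eqP := haar_neq0 haar_mu; apply.
rewrite (haar_inner haar_mu openT).
apply/eqP; rewrite eq_le; apply/andP; split; last first.
  apply: ereal_sup_ubound; exists set0; last by rewrite measure0.
  by split => //; exact: compact0.
apply: ge_ereal_sup => _ [C [cC _] <-].
move: (cC); rewrite compact_cover => /(_ _ setT (fun g => [set (g * x)%g | x in A^°])).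
case.
- by move=> g _; apply: open_mulgl; exact: open_interior.
- by move=> g _; exists g => //; exists 1%g => //; rewrite mulg1.
move=> D _ /subset_trans CD.
have : mu.-negligible (\bigcup_(g in [set` D]) [set (g * x)%g | x in A]).
  rewrite bigcup_fset; elim: (finmap.enum_fset D) => [|g r IH].
    by rewrite big_nil; exact: negligible_set0.
  rewrite big_cons; apply: negligibleU => //.
  exists [set (g * x)%g | x in A]; split => //.
    by apply: compact_borel; exact: compact_mulgl.
  by rewrite -[RHS]A0; apply: haar_invariant => //; exact: compact_borel.
case=> N [mN N0 DN]; rewrite le_eqVlt; apply/orP; left; apply/eqP.
apply: (@subset_measure0 _ (borel G) _ mu _ N) => //; first exact: compact_borel.
apply: CD; apply: (@subset_trans _ _ _ _ _ DN).
by apply: subset_bigcup => g _; apply: image_subset; exact: interior_subset.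
Qed.

(** This is psi_B. The default values of [fine] at infinity and of division by zero do not occur
    when [B] is compact of positive measure. *)
Definition translation_defect B s : R :=
  fine (mu ([set (s * x)%g | x in B] `\` B)) / fine (mu B).

Variable B : set G.
Hypotheses (compactB : compact B) (muB_gt0 : (0 < mu B)%E).

Let mB : measurable (B : set (borel G)). Proof. exact: compact_borel. Qed.
Let msB s : measurable ([set (s * x)%g | x in B] : set (borel G)).
Proof. by apply: compact_borel; exact: compact_mulgl. Qed.
Let muB_fin : mu B \is a fin_num. Proof. exact: haar_fin_num. Qed.
Let fB_gt0 : 0 < fine (mu B).
Proof. by apply: fine_gt0; rewrite muB_gt0 -ge0_fin_numE. Qed.
Let mu_sB s : mu [set (s * x)%g | x in B] = mu B.
Proof. exact: haar_invariant. Qed.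
Let muI_fin A : measurable (A : set (borel G)) -> mu (A `&` B) \is a fin_num.
Proof.
move=> mA; rewrite ge0_fin_numE ?measure_ge0//.
apply: le_lt_trans (measureIr _ _ _) _ => //.
by rewrite -ge0_fin_numE.
Qed.
Let muD_fin s A : measurable (A : set (borel G)) ->
  mu ([set (s * x)%g | x in B] `\` A) \is a fin_num.
Proof.
move=> mA; rewrite ge0_fin_numE ?measure_ge0//.
apply: (@le_lt_trans _ _ (mu [set (s * x)%g | x in B])).
  by apply: haar_le; [exact: borelD| |exact: subDsetl].
by rewrite mu_sB -ge0_fin_numE.
Qed.

Lemma translation_defectE s :
  translation_defect B s = 1 - fine (mu ([set (s * x)%g | x in B] `&` B)) / fine (mu B).
Proof.
rewrite /translation_defect haarD//; last by rewrite mu_sB -ge0_fin_numE.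
by rewrite mu_sB fineB ?muI_fin// mulrBl divff// gt_eqF.
Qed.

Lemma translation_defect_ge0 s : 0 <= translation_defect B s.
Proof. by rewrite divr_ge0 ?fine_ge0 ?measure_ge0. Qed.

Lemma translation_defect1 : translation_defect B 1%g = 0.
Proof. by rewrite /translation_defect mulgl_image1 setDv measure0 mul0r. Qed.

(** Translation by [s] carries the intersection of [s^-1 B] and [B] onto that of [B] and [sB]. *)
Lemma translation_defectV s : translation_defect B s^-1%g = translation_defect B s.
Proof.
rewrite !translation_defectE; congr (1 - fine _ / _).
rewrite -(haar_invariant haar_mu s); last exact: borelI.
by rewrite mulgl_imageI mulgl_image_comp mulgV mulgl_image1 setIC.
Qed.

(** A point of [stB] outside [B] lies either in [stB \ sB], a translate of [tB \ B], or in
    [sB \ B]. *)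
Lemma translation_defectM s t :
  translation_defect B (s * t)%g <= translation_defect B s + translation_defect B t.
Proof.
rewrite -mulrDl ler_pM2r ?invr_gt0// -fineD ?muD_fin//.
apply: fine_le; rewrite ?muD_fin ?fin_numD ?muD_fin//.
rewrite -(haar_invariant haar_mu s (A := [set (t * x)%g | x in B] `\` B)); last first.
  exact: borelD.
have -> : [set (s * x)%g | x in [set (t * x)%g | x in B] `\` B] =
    [set (s * t * x)%g | x in B] `\` [set (s * x)%g | x in B].
  by rewrite -mulgl_image_comp !(mulgl_imageE _ s).
rewrite addeC; apply: (le_trans _ (haarU_le _ _ (borelD _ _ _ _) (borelD _ _ _ _))) => //.
apply: haar_le; [exact: borelD|by apply: (@measurableU _ (borel G)); exact: borelD|].
move=> x [sBx nBx]; have [?|?] := pselect ([set (s * x)%g | x in B] x); first by right.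
by left.
Qed.

(** Outer regularity gives an open [U] containing [B] whose excess measure is below [e] times that
    of [B]; for [s] near the identity [sB] stays in [U]. *)
Lemma translation_defect_cvg1 e : 0 < e ->
  \forall s \near (1%g : G), translation_defect B s < e.
Proof.
move=> e0.
have : (mu B < mu B + (e * fine (mu B))%:E)%E by rewrite lteDl// lte_fin mulr_gt0.
rewrite {1}(haar_outer haar_mu mB) => /ereal_inf_lt[_ [U [oU BU] <-] muU].
apply: filterS (tube_mulgl _ _ _ compactB oU BU) => s sBU.
have mU : measurable (U : set (borel G)) by exact: sub_sigma_algebra.
rewrite /translation_defect ltr_pdivrMr// -lte_fin fineK ?muD_fin//.
have : (mu ([set (s * x)%g | x in B] `\` B) <= mu (U `\` B))%E.
  by apply: haar_le; [exact: borelD|exact: borelD|exact: setSD].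
move=> /le_lt_trans; apply.
rewrite haarD//; last first.
  by apply: (lt_trans muU); rewrite lte_add_pinfty ?ltry// -ge0_fin_numE.
by rewrite (setIidr BU) lteBlDl.
Qed.

Lemma translation_defect_eq1 s :
  [set (s * x)%g | x in B] `&` B = set0 -> translation_defect B s = 1.
Proof. by move=> sB; rewrite translation_defectE sB measure0 mul0r subr0. Qed.

Lemma translation_defect_le s A : compact A -> B `<=` A ->
  [set (s * x)%g | x in B] `<=` A ->
  translation_defect B s <= fine (mu A) / fine (mu B) - 1.
Proof.
move=> cA BA sBA; have mA := compact_borel _ cA.
rewrite -(@divff _ (fine (mu B))) ?gt_eqF// -mulrBl ler_pM2r ?invr_gt0//.
rewrite -fineB ?haar_fin_num//; apply: fine_le; rewrite ?muD_fin ?fin_numB ?haar_fin_num//.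
rewrite -[X in (_ - mu X)%E](setIidr BA) -haarD//; last by rewrite -ge0_fin_numE ?haar_fin_num.
by apply: haar_le; [exact: borelD|exact: borelD|exact: setSD].
Qed.

(** The constant 1 in the defect contributes the square of the sum of the [c i], which is 0. What
    remains is minus the Gram form of the translates [s i B], divided by the measure of [B]. *)
Lemma translation_defect_negative_type n (s : 'I_n -> G) (c : 'I_n -> R) :
  \sum_(i < n) c i = 0 ->
  \sum_(i < n) \sum_(j < n) c i * c j * translation_defect B ((s i)^-1 * s j)%g <= 0.
Proof.
move=> c0.
have h i j : c i * c j * translation_defect B ((s i)^-1 * s j)%g = c i * c j -
    c i * c j * fine (mu ([set (s i * x)%g | x in B] `&` [set (s j * x)%g | x in B]))
      / fine (mu B).
  rewrite translation_defectE -(haar_invariant haar_mu (s i)); last exact: borelI.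
  rewrite mulgl_imageI mulgl_image_comp mulVKg setIC; ring.
under eq_bigr do under eq_bigr do rewrite h.
under eq_bigr do rewrite sumrB -mulr_sumr c0 mulr0 add0r -mulr_suml.
rewrite sumrN oppr_le0 -mulr_suml. apply: divr_ge0; last exact: ltW.
by apply: gram_measure_ge0 => i //; rewrite mu_sB -ge0_fin_numE.
Qed.

End TranslationDefect.

Arguments translation_defect {R G} mu B s.

(** * Polynomial growth at dyadic scales *)

(** Multiplying [1 - t <= expR (- t)] by [expR t] gives [expR t <= 1 + t * expR t], and [t <= a]
    bounds the last factor. *)
Lemma expR_le1DxM (R : realType) (t a : R) : 0 <= t -> t <= a -> expR t <= 1 + t * expR a.
Proof.
move=> t0 ta; apply: (@le_trans _ _ (1 + t * expR t)); last first.
  by rewrite lerD2l ler_wpM2l// ler_expR.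
have : (1 - t) * expR t <= expR (- t) * expR t.
  by rewrite ler_wpM2r ?expR_ge0// expR_ge1Dx.
by rewrite -expRD addNr expR0; lra.
Qed.

Lemma pow2_le_expR (R : realType) n : 2 ^+ n <= expR n%:R :> R.
Proof.
rewrite -[n%:R]mulr1 expRM_natl lerXn2r ?nnegrE ?expR_ge0//.
by apply: le_trans (expR_ge1Dx _); rewrite -natr1.
Qed.

(* If every ratio on [2^j, 2^(j+1)) were larger, V would grow by a factor
   exp(A (j+1)) across this interval, against the polynomial bound. *)
Lemma dyadic_small_ratio (R : realType) (V : nat -> R) (c d : R) :
  {homo V : m n / (m <= n)%N >-> m <= n} -> 0 < V 1%N -> 0 < c -> 0 < d ->
  (forall n, (1 <= n)%N -> V n <= c * n.+1%:R `^ d) ->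
  exists2 C : R, 0 < C & forall j, exists2 k, (2 ^ j <= k < 2 ^ j.+1)%N &
    V k.+1 / V k - 1 <= C * j.+1%:R / 2 ^+ j.
Proof.
move=> Vle V1 c0 d0 Vub.
have Vgt0 n : (1 <= n)%N -> 0 < V n by move=> n1; exact: lt_le_trans V1 (Vle _ _ n1).
(* Chosen so that [A * (j + 1)] exceeds [(j + 2) * d + ln (c / V 1)] for every [j], which is the
   final contradiction. *)
pose A : R := 2 * d + `|ln (c / V 1%N)| + 1.
have A0 : 0 < A by rewrite ltr_wpDl// addr_ge0// mulr_ge0// ltW.
exists (A * expR A); first by rewrite mulr_gt0// expR_gt0.
move=> j; apply: contrapT => noscale.
set N := (2 ^ j)%N; set t : R := A * j.+1%:R / 2 ^+ j.
have N0 : (0 < N)%N by rewrite expn_gt0.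
have NE : 2 ^+ j = N%:R :> R by rewrite natrX.
have t0 : 0 <= t by rewrite divr_ge0// ?exprn_ge0// mulr_ge0// ltW.
have tA : t <= A.
  rewrite /t NE ler_pdivrMr ?ltr0n//; apply: ler_wpM2l; first exact: ltW.
  by rewrite ler_nat; exact: ltn_expl.
(* A failing [k] has ratio above [1 + t * expR A], hence at least [expR t], since [t] lies between 0
   and [A]. *)
have step k : (N <= k < 2 ^ j.+1)%N -> expR t * V k <= V k.+1.
  move=> kN; have Vk : 0 < V k by apply: Vgt0; case/andP: kN => /(leq_trans N0).
  rewrite leNgt; apply/negP => Vk1; apply: noscale; exists k => //.
  rewrite lerBlDr ler_pdivrMr//; apply: le_trans (ltW Vk1) _.
  rewrite ler_pM2r//; apply: le_trans (expR_le1DxM _ _ _ t0 tA) _.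
  by rewrite addrC lerD2r (_ : t * expR A = A * expR A * j.+1%:R / 2 ^+ j)// /t; ring.
have grow i : (i <= N)%N -> expR (i%:R * t) * V 1%N <= V (N + i)%N.
  elim: i => [_|i IH iN]; first by rewrite mul0r expR0 mul1r addn0; exact: Vle.
  rewrite addnS; apply: le_trans (step _ _); last first.
    by rewrite leq_addr/= expnS mul2n -addnn ltn_add2l.
  by rewrite -natr1 mulrDl mul1r addrC expRD -mulrA ler_wpM2l ?expR_ge0 ?IH// ltnW.
have := grow N (leqnn N); rewrite addnn -mul2n.
have -> : N%:R * t = A * j.+1%:R.
  by rewrite /t NE mulrC divfK// pnatr_eq0 -lt0n.
apply/negP; rewrite -ltNge.
apply: le_lt_trans (Vub _ _) _; first by rewrite mul2n double_gt0.
(* The polynomial bound at [2 * N] involves [2 * N + 1], which is at most [4 * N = 2 ^ (j + 2)]. *)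
have n2 : (2 * N).+1%:R <= expR j.+2%:R :> R.
  apply: le_trans (pow2_le_expR _ _).
  by rewrite -natrX ler_nat !expnS -/N (mul2n (2 * N)) -addnn -addn1 leq_add2l muln_gt0.
apply: (@le_lt_trans _ _ (c * expR (j.+2%:R * d))).
  by rewrite ler_pM2l// expRM ge0_ler_powR ?nnegrE ?expR_ge0// ltW.
have -> : c = expR (ln (c / V 1%N)) * V 1%N.
  by rewrite lnK ?posrE ?divr_gt0// divfK// gt_eqF.
rewrite mulrAC ltr_pM2r// -expRD ltr_expR /A.
set L := ln _; have LL : L <= `|L| := ler_norm L.
have LJ : `|L| <= `|L| * j.+1%:R by rewrite ler_peMr// ler1n.
have j0 : 0 <= j%:R :> R by [].
have : j%:R * d >= 0 by rewrite mulr_ge0// ltW.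
by move: LJ; rewrite -!(natr1 _.+1) -(natr1 j); nra.
Qed.

(** Telescoping: [1 / (i + 1)^2] is at most [1 / i - 1 / (i + 1)]. *)
Lemma sum_inv_sq_le (R : realType) (m n : nat) : (0 < m)%N ->
  \sum_(m <= i < n) i.+1%:R ^- 2 <= m%:R^-1 :> R.
Proof.
move=> m0; have [mn|nm] := leqP m n; last by rewrite big_geq ?invr_ge0// ltnW.
apply: (@le_trans _ _ (m%:R^-1 - n%:R^-1)); last by rewrite gerBl invr_ge0.
rewrite -(subnKC mn); elim: (n - m)%N => [|k IH]; first by rewrite addn0 big_geq// subrr.
rewrite addnS big_nat_recr ?leq_addr//=; apply: le_trans (lerD IH (lexx _)) _.
set p := (m + k)%N; have p0 : 0 < p%:R :> R by rewrite ltr0n addn_gt0 m0.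
rewrite -natr1; set x : R := p%:R in p0 *.
rewrite -subr_ge0.
have -> : m%:R^-1 - (x + 1)^-1 - (m%:R^-1 - x^-1 + (x + 1) ^- 2) = 1 / (x * (x + 1) ^+ 2).
  by field; rewrite -/x (gt_eqF p0) !gt_eqF ?ltr0n ?addr_gt0.
by rewrite divr_ge0// mulr_ge0 ?sqr_ge0 ?(ltW p0).
Qed.

(** The cubic term of the exponential series gives [u^3 / 6 <= expR u], applied to
    [u = j * y * ln 2]. *)
Lemma cube_le_pow2 (R : realType) (y : R) : 0 < y ->
  exists2 D : R, 0 < D & forall j, j%:R ^+ 3 <= D * 2 `^ (j%:R * y).
Proof.
move=> y0; have l0 : 0 < ln 2 :> R by rewrite ln_gt0// ltr1n.
exists (6 / (ln 2 * y) ^+ 3); first by rewrite divr_gt0// exprn_gt0// mulr_gt0.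
move=> j; rewrite /powR pnatr_eq0/=.
have h0 : 0 <= j%:R * y * ln 2 by rewrite !mulr_ge0 ?(ltW y0) ?(ltW l0).
have h := expR_ge1Dxn 2 h0.
rewrite mulrAC ler_pdivlMr ?exprn_gt0 ?mulr_gt0//.
have {h} : (j%:R * y * ln 2) ^+ 3 / 6 <= expR (j%:R * y * ln 2).
  by apply: le_trans h; rewrite lerDr.
rewrite ler_pdivrMr// [_ * 6]mulrC.
by rewrite (_ : _ ^+ 3 = j%:R ^+ 3 * (ln 2 * y) ^+ 3)//; ring.
Qed.

(** * Series of subadditive functions *)

Section SubadditiveSeries.
Variables (R : realType) (G : topologicalGroupType) (K : set G).
Hypotheses (K1 : nbhs (1%g : G) K) (KV : [set x^-1%g | x in K] = K) (genK : generating K).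
Variables (f : nat -> G -> R) (C : R).
Hypotheses (f_ge0 : forall j s, 0 <= f j s) (f1 : forall j, f j 1%g = 0).
Hypothesis fV : forall j s, f j s^-1%g = f j s.
Hypothesis fM : forall j s t, f j (s * t)%g <= f j s + f j t.
Hypothesis f_near1 : forall j e, 0 < e -> \forall s \near (1%g : G), f j s < e.
Hypothesis fK : forall j s, K s -> f j s <= C * j.+1%:R ^- 2.

(** [limn] is meaningful only for convergent partial sums; convergence at every [s] is
    [series_fun_is_cvg]. *)
Definition series_fun s : R := limn (series (f ^~ s)).

Lemma series_fun_nondecreasing s : nondecreasing_seq (series (f ^~ s)).
Proof. by apply/nondecreasing_seqP => n; rewrite (seriesSr _ n) lerDl. Qed.

Lemma subadditive_set_power_le j n s :
  set_power K n s -> f j s <= n%:R * (C * j.+1%:R ^- 2).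
Proof.
elim: n s => [|n IH] s; first by rewrite set_power0 => ->; rewrite f1 mul0r.
move=> /set_powerSP[x [k [Kx Kk ->]]]; apply: le_trans (fM _ _ _) _.
by rewrite -natr1 mulrDl mul1r lerD// ?IH ?fK.
Qed.

(** The tail bound is uniform in [s] over the neighbourhood [K] of the identity, which is what
    continuity there needs. *)
Lemma series_tail_le s m n : K s -> (0 < m <= n)%N ->
  series (f ^~ s) n <= series (f ^~ s) m + C * m%:R^-1.
Proof.
move=> Ks /andP[m0 mn]; rewrite -lerBlDl sub_series_geq//.
have C0 : 0 <= C by have := le_trans (f_ge0 0 s) (fK 0 s Ks); rewrite expr1n invr1 mulr1.
apply: (@le_trans _ _ (\sum_(m <= i < n) C * i.+1%:R ^- 2)).
  by apply: ler_sum => i _; exact: fK.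
by rewrite -mulr_sumr ler_wpM2l// sum_inv_sq_le.
Qed.

(** Any [s] lies in some power [K^n], where subadditivity costs only a factor [n] in the summable
    bound on [K]. *)
Lemma series_fun_is_cvg s : cvgn (series (f ^~ s)).
Proof.
have [n Kn] := set_power_exhaust G K KV genK s.
apply: nondecreasing_is_cvgn; first exact: series_fun_nondecreasing.
have K1' := nbhs_singleton K1.
have C0 : 0 <= C by have := le_trans (f_ge0 0 _) (fK 0 _ K1'); rewrite expr1n invr1 mulr1.
(* The 2 bounds the sum of the inverse squares: 1 for the first term and at most 1 for the
   others. *)
exists (n%:R * C * 2) => _ [m _ <-].
apply: (@le_trans _ _ (\sum_(0 <= i < m.+1) n%:R * (C * i.+1%:R ^- 2))).
  apply: (le_trans (series_fun_nondecreasing s _ _ (leqnSn m))).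
  by apply: ler_sum => i _; exact: subadditive_set_power_le.
rewrite -mulr_sumr -mulr_sumr mulrA ler_wpM2l ?mulr_ge0// big_nat_recl// expr1n invr1.
rewrite -[2]/(1 + 1) lerD2l.
have := sum_inv_sq_le R 1 m.+1 isT; rewrite invr1; apply: le_trans.
by rewrite big_add1.
Qed.

Lemma series_fun_ge n s : series (f ^~ s) n <= series_fun s.
Proof.
by apply: nondecreasing_cvgn_le; [exact: series_fun_nondecreasing|exact: series_fun_is_cvg].
Qed.

Lemma series_fun_ge_term j s : f j s <= series_fun s.
Proof.
apply: le_trans (series_fun_ge j.+1 s); rewrite (seriesSr _ j) lerDr.
by apply: sumr_ge0 => i _.
Qed.

Lemma series_fun_ge0 s : 0 <= series_fun s.
Proof. exact: le_trans (f_ge0 0 s) (series_fun_ge_term 0 s). Qed.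

Lemma series_fun_1 : series_fun 1%g = 0.
Proof.
rewrite /series_fun (_ : series _ = cst 0) ?lim_cst//.
by apply/funext => n; rewrite seriesEnat/= big1.
Qed.

Lemma series_funV s : series_fun s^-1%g = series_fun s.
Proof. by rewrite /series_fun; under eq_fun do rewrite fV. Qed.

Lemma series_funM s t : series_fun (s * t)%g <= series_fun s + series_fun t.
Proof.
apply: limr_le; first exact: series_fun_is_cvg.
apply: nearW => n; apply: le_trans (lerD (series_fun_ge n s) (series_fun_ge n t)).
by rewrite !seriesEnat/= -big_split/=; apply: ler_sum => i _; exact: fM.
Qed.

(** On [K] the tail beyond a fixed [m] is uniformly below [e / 2]; the finitely many earlier terms
    are small near the identity. *)
Lemma series_fun_near1 e : 0 < e -> \forall s \near (1%g : G), series_fun s < e.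
Proof.
move=> e0.
pose m := (Num.trunc (2 * `|C| / e)).+1.
have Cm : C * m%:R^-1 < e / 2.
  have : 2 * `|C| / e < m%:R by exact: truncnS_gt.
  rewrite !ltr_pdivrMr ?ltr0n// => h; apply: le_lt_trans (ler_norm _) _; lra.
have : \forall s \near (1%g : G), series (f ^~ s) m < e / 2.
  have : 0 < e / 2 by rewrite divr_gt0.
  elim: m {Cm} (e / 2) => [|n IH] x x0.
    by apply: nearW => s; rewrite seriesEnat/= big_geq.
  have x2 : 0 < x / 2 by rewrite divr_gt0.
  apply: filterS2 (IH _ x2) (f_near1 n _ x2) => s h1 h2.
  by rewrite (seriesSr _ n) [ltRHS](splitr x) ltrD.
move=> fm; near=> s.
have Ks : K s by near: s.
apply: (@le_lt_trans _ _ (series (f ^~ s) m + C * m%:R^-1)).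
  apply: limr_le; first exact: series_fun_is_cvg.
  by near=> n; apply: series_tail_le => //; rewrite /m/=; near: n; exact: nbhs_infty_ge.
by rewrite [ltRHS](splitr e) ltrD//; near: s.
Unshelve. all: by end_near. Qed.

(** Subadditivity and symmetry bound the difference of the values at [s] and [t] by the value at
    [s^-1 t], which reduces continuity to the identity. *)
Lemma series_fun_continuous : continuous series_fun.
Proof.
move=> s; apply/cvgrPdist_lt => e e0.
have h : (fun t => s^-1 * t)%g t @[t --> s] --> (1%g : G).
  by rewrite -(mulVg s); exact: mulgl_continuous.
have near_te := h _ (series_fun_near1 e e0); near=> t.
have te : series_fun (s^-1 * t)%g < e by near: t; exact: near_te.
rewrite ltr_distlC; apply/andP; split.
  rewrite ltrBlDr; apply: le_lt_trans (_ : series_fun t + series_fun (s^-1 * t)%g < _).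
    rewrite -[X in _ + X]series_funV invgM invgK -[in leLHS](mulVKg t s).
    exact: series_funM.
  by rewrite ltrD2l.
rewrite -[t in ltLHS](mulVKg s); apply: le_lt_trans (series_funM _ _) _.
by rewrite ltrD2l.
Unshelve. all: by end_near. Qed.

Hypothesis f_neg : forall j n (s : 'I_n -> G) (c : 'I_n -> R),
  \sum_(i < n) c i = 0 ->
  \sum_(i < n) \sum_(k < n) c i * c k * f j ((s i)^-1 * s k)%g <= 0.

(** The form is the limit of the forms of the partial sums, and these are sums of nonpositive
    terms. *)
Lemma series_fun_neg n (s : 'I_n -> G) (c : 'I_n -> R) :
  \sum_(i < n) c i = 0 ->
  \sum_(i < n) \sum_(k < n) c i * c k * series_fun ((s i)^-1 * s k)%g <= 0.
Proof.
move=> c0.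
have h : (\sum_(i < n) \sum_(k < n) c i * c k * series (f ^~ ((s i)^-1 * s k)%g) m)
   @[m --> \oo] --> \sum_(i < n) \sum_(k < n) c i * c k * series_fun ((s i)^-1 * s k)%g.
  apply: (cvg_big add_continuous) => i _; apply: (cvg_big add_continuous) => k _.
  by apply: cvgMr; exact: series_fun_is_cvg.
rewrite -(cvg_lim _ h)//; apply: limr_le; first by apply/cvg_ex; eexists; exact: h.
apply: nearW => m.
have -> : \sum_(i < n) \sum_(k < n) c i * c k * series (f ^~ ((s i)^-1 * s k)%g) m =
  \sum_(0 <= j < m) \sum_(i < n) \sum_(k < n) c i * c k * f j ((s i)^-1 * s k)%g.
  rewrite [RHS]exchange_big/=; apply: eq_bigr => i _.
  rewrite [RHS]exchange_big/=; apply: eq_bigr => k _.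
  by rewrite seriesEnat/= mulr_sumr.
by apply: sumr_le0 => j _; exact: f_neg.
Qed.

End SubadditiveSeries.

(** * From real to complex coefficients *)

(** Writing [c = a + i b], the real part of the hermitian form is the sum of the real forms at [a]
    and at [b]; the imaginary part cancels by symmetry of the kernel. *)
Lemma real_negative_type (R : realType) (G : topologicalGroupType) (l : G -> R) :
  (forall s, 0 <= l s) -> l 1%g = 0 -> (forall s, l s^-1%g = l s) ->
  (forall n (s : 'I_n -> G) (c : 'I_n -> R), \sum_(i < n) c i = 0 ->
    \sum_(i < n) \sum_(j < n) c i * c j * l ((s i)^-1 * s j)%g <= 0) ->
  negative_type l.
Proof.
move=> l0 l1 lV lneg; split => // n s c c0.
pose a i := complex.Re (c i); pose b i := complex.Im (c i).
have sumc m (x y : 'I_m -> R) :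
    \sum_(i < m) Complex (x i) (y i) = Complex (\sum_(i < m) x i) (\sum_(i < m) y i).
  by apply: (big_rec3 (fun u v w => u = Complex v w)) => //= i u v w _ ->.
have cE i : c i = Complex (a i) (b i) by rewrite /a /b; case: (c i).
have [a0 b0] : \sum_(i < n) a i = 0 /\ \sum_(i < n) b i = 0.
  by move: c0; under eq_bigr do rewrite cE; rewrite sumc => -[].
pose L i j := l ((s i)^-1 * s j)%g.
have LC i j : L i j = L j i by rewrite /L -lV invgM invgK.
have cLE i j : (c i)^* * c j * (L i j)%:C%C =
    Complex (a i * a j * L i j + b i * b j * L i j) (a i * b j * L i j - b i * a j * L i j).
  rewrite (cE i) (cE j); apply/eqP; rewrite eq_complex/=.
  by apply/andP; split; apply/eqP; ring.
under eq_bigr do under eq_bigr do rewrite cLE.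
under eq_bigr do rewrite sumc.
(* The order on [R[i]] compares real parts and requires equal imaginary parts. *)
rewrite sumc lecE/=; apply/andP; split.
  under eq_bigr do rewrite sumrB.
  rewrite sumrB eq_sym subr_eq0 [X in _ == X]exchange_big/=; apply/eqP.
  apply: eq_bigr => i _; apply: eq_bigr => j _; rewrite (LC j); ring.
under eq_bigr do rewrite big_split.
by rewrite big_split/= -[leRHS]addr0 lerD// lneg.
Qed.

(** * Growth of sublevel sets *)

(** Of the cube, one factor [j + 1] cancels the one in the ratio bound at scale [j], and the other
    two make the series converge. *)
Definition dyadic_weight (R : realType) j : R := 2 ^+ j / j.+1%:R ^+ 3.

(** The weights are not monotone (they start 1, 1/4), so [j + 1] is taken to be the least index
    whose weight exceeds [x]; it is not 0 because the weight at 0 is 1. *)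
Lemma dyadic_weight_bracket (R : realType) (x : R) : 1 <= x ->
  exists j, dyadic_weight R j <= x < dyadic_weight R j.+1.
Proof.
move=> x1.
have [D D0 cubeD] := cube_le_pow2 R 2^-1 ltac:(by rewrite invr_gt0).
have unbounded : exists j, x < dyadic_weight R j.
  pose i := (Num.trunc (2 * D * x)).+1.
  have xi : 2 * D * x < i%:R by exact: truncnS_gt.
  (* At this index the denominator is [(2 i)^3], at most [D * 2^i] by the cube bound with exponent
     1/2. The weight is then at least [2^i / (2 D)], and [2^i] exceeds [2 * D * x]. *)
  exists i.*2.-1; rewrite /dyadic_weight prednK ?double_gt0//.
  have /le_lt_trans : i.*2%:R ^+ 3 <= D * 2 ^+ i.
    apply: le_trans (cubeD _) _; rewrite ler_pM2l// -mul2n natrM mulrAC divff// mul1r.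
    by rewrite powR_mulrn.
  rewrite ltr_pdivlMr ?exprn_gt0 ?ltr0n ?double_gt0// => h.
  rewrite mulrC -ltr_pdivlMr ?(lt_le_trans _ x1)//; apply: h.
  rewrite ltr_pdivlMr ?(lt_le_trans _ x1)//.
  have -> : 2 ^+ i.*2.-1 = 2 ^+ i * 2 ^+ i / 2 :> R.
    by rewrite -exprD addnn -(@prednK i.*2) ?double_gt0// exprS mulrC mulKf.
  rewrite ltr_pdivlMr// (_ : _ * 2 = 2 ^+ i * (2 * D * x)); last by ring.
  rewrite ltr_pM2l ?exprn_gt0// (lt_le_trans xi)//.
  by rewrite -natrX ler_nat ltnW// ltn_expl.
have [[|j] xj jmin] := ex_minnP unbounded.
  by move: xj; rewrite /dyadic_weight expr0 expr1n divff// ltNge x1.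
by exists j; rewrite xj andbT leNgt; apply/negP => /jmin; rewrite ltnn.
Qed.

Lemma dyadic_weight_le (R : realType) j : dyadic_weight R j <= 2 ^+ j.
Proof.
by rewrite ler_pdivrMr ?exprn_gt0// ler_peMr ?exprn_ge0// exprn_ege1// ler1n.
Qed.

(* The cubic factor of the weight is absorbed by 2^(j y) with y = 1 - p / d. *)
Lemma dyadic_weight_pow (R : realType) (p d : R) : 0 <= p -> p < d ->
  exists2 D : R, 0 <= D & forall j (x : R), dyadic_weight R j <= x ->
    2 `^ (j%:R * p) <= D * x `^ d.
Proof.
move=> p0 pd; have d0 : 0 < d by exact: le_lt_trans pd.
pose y := 1 - p / d.
have y0 : 0 < y by rewrite subr_gt0 ltr_pdivrMr// mul1r.
have [D D0 cubeD] := cube_le_pow2 R y y0.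
exists ((D * 2 `^ y) `^ d); first exact: powR_ge0.
move=> j x; rewrite ler_pdivrMr ?exprn_gt0// => jx.
have x0 : 0 <= x.
  have : 0 < x * j.+1%:R ^+ 3 by apply: lt_le_trans jx; rewrite exprn_gt0.
  by rewrite pmulr_lgt0 ?exprn_gt0// => /ltW.
rewrite -powRM ?mulr_ge0 ?powR_ge0 ?(ltW D0)//.
(* Both sides become [d]-th powers, so it suffices to bound [2^(j (1 - y))] by [D * 2^y * x];
   multiplied by [2^(j y)], this is the cube bound at [j + 1]. *)
have -> : j%:R * p = j%:R * (1 - y) * d.
  by rewrite /y; field; rewrite gt_eqF.
rewrite powRrM; apply: ge0_ler_powR; rewrite ?nnegrE ?powR_ge0 ?(ltW d0)//.
  by rewrite !mulr_ge0 ?powR_ge0 ?(ltW D0).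
have p2 : 0 < 2 `^ (j%:R * y) :> R by rewrite powR_gt0.
rewrite -(ler_pM2r p2) -powRD; last by rewrite pnatr_eq0 implybT.
rewrite -mulrDr subrK mulr1 powR_mulrn//; apply: le_trans jx _.
apply: le_trans (ler_wpM2l x0 (cubeD _)) _.
rewrite -(natr1 j) mulrDl mul1r powRD; last by rewrite pnatr_eq0 implybT.
by rewrite le_eqVlt; apply/orP; left; apply/eqP; ring.
Qed.

Section SublevelGrowth.
Variables (R : realType) (G : topologicalGroupType).
Variables (mu : {measure set (borel G) -> \bar R}) (K : set G).
Hypotheses (hausdorffG : hausdorff_space G) (compactK : compact K).
Variable l : G -> R.
Hypothesis l_continuous : continuous l.
Hypothesis l_ge : forall j s, ~ set_power K (2 ^ j.+2) s -> dyadic_weight R j <= l s.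

Lemma closed_sublevel x : closed [set s | l s <= x].
Proof.
by apply: (@closed_comp _ _ l [set y | y <= x]) => //.
Qed.

Lemma sublevel_sub_set_power j x :
  x < dyadic_weight R j -> [set s | l s <= x] `<=` set_power K (2 ^ j.+2).
Proof.
move=> xj s /= lsx; apply: contrapT => /l_ge.
by apply/negP; rewrite -ltNge (le_lt_trans lsx).
Qed.

Lemma proper_of_dyadic : proper_function l.
Proof.
(* The bracket requires a value at least 1, hence [1 + x]. *)
move=> x x0; have [j /andP[_ xj]] := dyadic_weight_bracket R (1 + x) ltac:(by rewrite lerDl).
apply: (subclosed_compact (closed_sublevel x)); last first.
  by apply: (@sublevel_sub_set_power j.+1); apply: le_lt_trans xj; rewrite lerDr.
exact: compact_set_power.
Qed.

(** For [x] between the weights at [j] and [j + 1], the sublevel set lies in [K^(2^(j+3))], of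
    measure at most [C * 2^((j+3) p)]. The shift by 3 costs the constant [2^(3 p)], and [2^(j p)] is
    at most [D * x^d]. *)
Lemma sublevel_bigO_of_dyadic (C p d : R) n0 : 0 <= C -> 0 <= p -> p < d ->
  (forall n, (n0 <= n)%N -> (mu (set_power K n) <= (C * n%:R `^ p)%:E)%E) ->
  sublevel_bigO mu l d.
Proof.
move=> C0 p0 pd muK.
have [D D0 powD] := dyadic_weight_pow R p d p0 pd.
exists (C * (2 `^ (3 * p) * D)).
near=> x.
have x1 : 1 <= x by near: x; exact: nbhs_pinfty_ge.
have xn0 : n0%:R <= x by near: x; exact: nbhs_pinfty_ge.
have [j /andP[jx xj]] := dyadic_weight_bracket R x x1.
have jn0 : (n0 <= 2 ^ j.+3)%N.
  rewrite -(ler_nat R) natrX (le_trans xn0)// (le_trans (ltW xj))//.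
  apply: le_trans (dyadic_weight_le _ _) _.
  by apply: ler_weXn2l; rewrite ?ler1n// -addn2 leq_addr.
apply: (@le_trans _ _ (mu (set_power K (2 ^ j.+3)))).
  apply: haar_le; last exact: sublevel_sub_set_power.
    by apply: closed_borel; exact: closed_sublevel.
  exact: (compact_borel _ hausdorffG _ (compact_set_power _ _ _ compactK)).
apply: le_trans (muK _ jn0) _; rewrite lee_fin -!mulrA ler_wpM2l//.
rewrite natrX -powR_mulrn// -powRrM -addn3 natrD mulrDl.
rewrite powRD ?pnatr_eq0 ?implybT// mulrC ler_wpM2l ?powR_ge0//.
exact: powD.
Unshelve. all: by end_near. Qed.

End SublevelGrowth.

(** * Exponents above the homogeneous dimension *)

(** The upper limit is an infimum of suprema over neighbourhoods of infinity, so one such supremum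
    is already below [d] and serves as exponent, up to making it nonnegative. *)
Lemma homogeneous_dimension_bound (R : realType) (G : topologicalGroupType)
    (mu : {measure set (borel G) -> \bar R}) (K : set G) (d v : R) : 0 < v ->
  (forall n, mu (set_power K n) \is a fin_num) ->
  (forall n, (1 <= n)%N -> (v%:E <= mu (set_power K n))%E) ->
  (homogeneous_dimension mu K < d%:E)%E ->
  exists p n0, [/\ 0 <= p, p < d & forall n, (n0 <= n)%N ->
    (mu (set_power K n) <= (1 * n%:R `^ p)%:E)%E].
Proof.
move=> v0 muK_fin muK_ge /ereal_inf_lt[_ [A [N _ NA] <-] Sd].
set S := ereal_sup _ in Sd.
pose V n := fine (mu (set_power K n)).
have VE n : mu (set_power K n) = (V n)%:E by rewrite fineK.
have Vv n : (1 <= n)%N -> v <= V n by move=> /muK_ge; rewrite VE lee_fin.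
have ln_gt0 n : (1 < n)%N -> 0 < ln n%:R :> R by move=> n1; rewrite ln_gt0// ltr1n.
(* From 2 on [ln n] is positive, so the quotient is not a default value. *)
have uS n : (maxn N 2 <= n)%N -> ((ln (V n) / ln n%:R)%:E <= S)%E.
  rewrite geq_max => /andP[Nn n1]; apply: ereal_sup_ubound; exists n; first exact: NA.
  by rewrite VE lne_EFin ?(lt_le_trans v0) ?Vv// ltnW.
have S_fin : S \is a fin_num.
  rewrite fin_numElt (lt_trans Sd) ?ltry// andbT.
  by apply: lt_le_trans (uS _ (leqnn _)); rewrite ltNyr.
have {Sd}rd : fine S < d by rewrite -lte_fin fineK.
set r := fine S in rd.
have {uS}lnV n : (maxn N 2 <= n)%N -> ln (V n) <= r * ln n%:R.
  move=> Nn; have /uS := Nn; rewrite -[S]fineK// lee_fin ler_pdivrMr// ln_gt0//.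
  by move: Nn; rewrite geq_max => /andP[].
(* Otherwise [r < 0], and [V n <= n^r] falls below the lower bound [v] once [n] passes
   [expR (ln v / r)]. *)
have d0 : 0 < d.
  rewrite ltNge; apply/negP => dle0; have r0 : r < 0 by exact: lt_le_trans rd _.
  pose n := (maxn (maxn N 2) (Num.trunc (expR (ln v / r))).+1).
  have nN : (maxn N 2 <= n)%N by exact: leq_maxl.
  have n2 : (1 < n)%N by move: nN; rewrite geq_max => /andP[].
  have : ln v / r < ln n%:R.
    rewrite -ltr_expR lnK ?posrE ?ltr0n; last by rewrite ltnW.
    by apply: (lt_le_trans (truncnS_gt _)); rewrite ler_nat leq_maxr.
  rewrite ltr_ndivrMr// mulrC; apply/negP; rewrite -leNgt.
  apply: le_trans (lnV _ nN); rewrite ler_ln ?posrE ?Vv ?(ltnW n2)//.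
  by rewrite (lt_le_trans v0)// Vv// ltnW.
(* The supremum [r] may be negative; [d / 2] keeps the exponent nonnegative and below [d]. *)
exists (Num.max r (d / 2)), (maxn N 2); split.
- by rewrite le_max (ltW (divr_gt0 _ _)) ?orbT.
- by rewrite gt_max rd ltr_pdivrMr// ltr_pMr// ltr1n.
move=> n nN; have /andP[_ n2] : (N <= n)%N && (2 <= n)%N by rewrite -geq_max.
rewrite VE lee_fin mul1r /powR pnatr_eq0 gt_eqF; last by apply: leq_trans n2.
have Vn0 : 0 < V n by rewrite (lt_le_trans v0)// Vv// ltnW.
rewrite -[leLHS]lnK ?posrE// ler_expR; apply: le_trans (lnV _ nN) _.
by rewrite ler_wpM2r ?le_max ?lexx// ltW// ln_gt0.
Qed.

(** * The weighted series of translation defects at the chosen scales *)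

Theorem theorem1p2 (R : realType) (G : topologicalGroupType)
    (mu : {measure set (borel G) -> \bar R}) (K : set G)
    (hausdorffG : hausdorff_space G)
    (locally_compactG : locally_compact [set: G])
    (second_countableG : @second_countable G)
    (haar_mu : left_haar mu)
    (growth_setK : growth_set K)
    (growthG : group_polynomial_growth mu K) :
  exists l : G -> R,
    [/\ continuous l, proper_function l, negative_type l,
        function_polynomial_growth mu l &
        forall d : R, (homogeneous_dimension mu K < d%:E)%E ->
          sublevel_bigO mu l d].
Proof.
have [cK KV genK nK] := growth_setK.
have [c [D [c0 D0 muK_le]]] := growthG.
have K1 : K 1%g := nbhs_singleton nK.
have cKn n : compact (set_power K n) by exact: compact_set_power.
have fin_muK n : mu (set_power K n) \is a fin_num by apply: haar_fin_num.
have mKn n : measurable (set_power K n : set (borel G)).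
  exact: (compact_borel _ hausdorffG _ (cKn n)).
pose V n : R := fine (mu (set_power K n)).
have VE n : mu (set_power K n) = (V n)%:E by rewrite fineK.
have V_homo : {homo V : m n / (m <= n)%N >-> m <= n}.
  move=> m n mn; rewrite -lee_fin -!VE; apply: haar_le => //; exact: set_power_sub.
have V1 : 0 < V 1%N.
  by rewrite -lte_fin -VE set_power1; apply: haar_nbhs_gt0.
have V_gt0 n : (1 <= n)%N -> 0 < V n by move=> n1; exact: lt_le_trans V1 (V_homo _ _ n1).
have V_le n : (1 <= n)%N -> V n <= c * n.+1%:R `^ D.
  by move=> n1; rewrite -lee_fin -VE; exact: muK_le.
have [C C0 ratio] := dyadic_small_ratio R V c D V_homo V1 c0 D0 V_le.
have /choice[k kP] : forall j, exists m, (2 ^ j <= m < 2 ^ j.+1)%N /\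
    V m.+1 / V m - 1 <= C * j.+1%:R / 2 ^+ j.
  by move=> j; have [m ? ?] := ratio j; exists m.
have k_gt0 j : (1 <= k j)%N.
  by have [/andP[+ _] _] := kP j; apply: leq_trans; rewrite expn_gt0.
have mu_gt0 j : (0 < mu (set_power K (k j)))%E by rewrite VE lte_fin V_gt0.
pose w j : R := dyadic_weight R j.
have w_gt0 j : 0 < w j by rewrite divr_gt0 ?exprn_gt0.
pose f j s := w j * translation_defect mu (set_power K (k j)) s.
have f_ge0 j s : 0 <= f j s.
  by apply: mulr_ge0; [exact: ltW|exact: translation_defect_ge0].
have f1 j : f j 1%g = 0 by rewrite /f translation_defect1 mulr0.
have fV j s : f j s^-1%g = f j s by rewrite /f translation_defectV.
have fM j s t : f j (s * t)%g <= f j s + f j t.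
  by rewrite -mulrDr ler_pM2l//; apply: translation_defectM.
have f_near1 j e : 0 < e -> \forall s \near (1%g : G), f j s < e.
  move=> e0; near=> s; rewrite /f mulrC -ltr_pdivlMr//; near: s.
  by apply: translation_defect_cvg1 => //; rewrite divr_gt0.
(* For [s] in [K] both [B = K^(k j)] and [sB] lie in [K^(k j + 1)], so the small ratio bounds the
   defect; the weight turns [C (j + 1) / 2^j] into exactly [C / (j + 1)^2]. *)
have fK j s : K s -> f j s <= C * j.+1%:R ^- 2.
  move=> Ks; have [_ small] := kP j.
  have sub : [set (s * x)%g | x in set_power K (k j)] `<=` set_power K (k j).+1.
    by move=> _ [x Kx <-]; rewrite -add1n; apply: set_power_mul; rewrite ?set_power1.
  have defect_le := translation_defect_le R G mu hausdorffG haar_mu _ (cKn (k j)) (mu_gt0 j)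
    s _ (cKn (k j).+1) (set_power_sub G _ _ _ K1 (leqnSn _)) sub.
  apply: le_trans (ler_wpM2l (ltW (w_gt0 j)) (le_trans defect_le small)) _.
  rewrite /w /dyadic_weight le_eqVlt; apply/orP; left; apply/eqP; field.
  by rewrite addrC natr1 pnatr_eq0 expf_neq0.
have f_neg j n (s : 'I_n -> G) (a : 'I_n -> R) : \sum_(i < n) a i = 0 ->
    \sum_(i < n) \sum_(m < n) a i * a m * f j ((s i)^-1 * s m)%g <= 0.
  move=> a0; rewrite /f.
  under eq_bigr do under eq_bigr do rewrite mulrCA.
  under eq_bigr do rewrite -mulr_sumr.
  rewrite -mulr_sumr pmulr_rle0//.
  by apply: translation_defect_negative_type.
pose l : G -> R := series_fun R G f.
have l_cont : continuous l by apply: (series_fun_continuous R G K nK KV genK f C).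
(* If [sx] and [x] both lie in [K^(k j)], then [s = (sx) x^-1] lies in [K^(2 k j)], and
   [2 k j <= 2^(j+2)]. Off that power the defect is therefore 1, and the [j]-th term alone gives the
   bound. *)
have l_ge j s : ~ set_power K (2 ^ j.+2) s -> dyadic_weight R j <= l s.
  move=> nKs; apply: (@le_trans _ _ (f j s)); last first.
    by apply: (series_fun_ge_term R G K nK KV genK f C).
  rewrite /f translation_defect_eq1 ?mulr1//; apply/seteqP; split => // _ [[x Kx <-] Ksx].
  apply: nKs; rewrite -(mulgK x s); have [/andP[_ k2] _] := kP j.
  apply: (set_power_sub _ _ (k j + k j)) => //.
    by rewrite expnS mul2n -addnn leq_add// ltnW.
  by apply: set_power_mul => //; exact: set_power_inv.
exists l; split => //.
- exact: (proper_of_dyadic R G K cK).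
- apply: real_negative_type.
  + exact: (series_fun_ge0 R G K nK KV genK f C).
  + exact: series_fun_1.
  + exact: series_funV.
  + exact: (series_fun_neg R G K nK KV genK f C).
(* Any exponent above the growth exponent [D] would do; [n + 1 <= 2 n] puts the growth bound in the
   required form, with constant [c * 2^D]. *)
- exists (D + 1); first by rewrite addr_gt0.
  apply: (sublevel_bigO_of_dyadic R G mu K hausdorffG cK l l_cont l_ge (c * 2 `^ D) D _ 1) => //.
  + by rewrite mulr_ge0 ?powR_ge0 ?(ltW c0).
  + exact: ltW.
  + by rewrite ltrDl.
  move=> n n1; apply: le_trans (muK_le _ n1) _.
  rewrite lee_fin -mulrA ler_pM2l// -powRM// ge0_ler_powR ?nnegrE ?(ltW D0)//.
  by rewrite -natrM ler_nat mul2n -addnn -addn1 leq_add2l.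
- move=> d dim_lt_d.
  have [|p [n0 [p0 pd muK_p]]] := homogeneous_dimension_bound _ _ _ _ _ _ V1 fin_muK _ dim_lt_d.
    by move=> n n1; rewrite VE lee_fin V_homo.
  exact: (sublevel_bigO_of_dyadic R G mu K hausdorffG cK l l_cont l_ge 1 p d n0).
Unshelve. all: by end_near. Qed.
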